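(* Let $\psi$ be a unit speed spacelike curve in $E_1^3$ with arclength parameter $s$, nowhere-zero curvature $\kappa$, and spacelike principal normal vector, which is a general helix whose tangent vector makes a constant Lorentzian timelike angle $\phi$ with a fixed spacelike straight line (the axis). Put $n=\cosh\phi$ and $m=\frac{n}{\sqrt{n^2-1}}$. Then, up to an isometry of $E_1^3$ carrying the axis to the direction of $\mathbf{e}_3=(0,0,1)$, and for a suitable choice of the constants of integration, the position vector of $\psi$ is given in natural representation by $$\psi(s)=\sqrt{n^2-1}\int\Big(\cosh\Big[\sqrt{m^2-1}\int\kappa(s)\,ds\Big],\ \sinh\Big[\sqrt{m^2-1}\int\kappa(s)\,ds\Big],\ m\Big)ds,$$ or, in parametric form with $\theta=\int\kappa(s)\,ds$, $$\psi(\theta)=\int\frac{\sqrt{n^2-1}}{\kappa(\theta)}\Big(\cosh[\sqrt{m^2-1}\,\theta],\ \sinh[\sqrt{m^2-1}\,\theta],\ m\Big)d\theta.$$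
   Context: $E_1^3$ is $\mathbb{R}^3$ with the Lorentzian metric $g=-dx_1^2+dx_2^2+dx_3^2$ and $\|a\|=\sqrt{|g(a,a)|}$. A vector $v$ is spacelike if $g(v,v)>0$ or $v=0$, timelike if $g(v,v)<0$, and null if $g(v,v)=0$ and $v\neq0$. A curve is spacelike if all its velocity vectors are spacelike. All curves are smooth. For a unit speed spacelike curve with spacelike or timelike principal normal $N$, the Frenet frame $\{T=\psi',N,B\}$, curvature $\kappa$ and torsion $\tau$ satisfy $T'=\kappa N$, $N'=-\varepsilon\kappa T+\tau B$, $B'=\tau N$, where $g(T,T)=1$, $g(N,N)=\varepsilon=\pm1$, $g(B,B)=-\varepsilon$, and $T,N,B$ are mutually orthogonal (so $\varepsilon=1$ when $N$ is spacelike). A general helix is a curve whose tangent lines make a constant angle with a fixed direction. If $X,Y$ are spacelike vectors spanning a timelike plane, then $|g(X,Y)|>\|X\|\,\|Y\|$ and the Lorentzian timelike angle between them is the unique positive real number $\phi$ with $|g(X,Y)|=\|X\|\,\|Y\|\cosh\phi$. The angle between $T$ and a line is the angle between $T$ and a direction vector of the line; thus here $n>1$ and $|g(T,\mathbf{d})|=n$ along the curve for a unit direction vector $\mathbf{d}$ of the axis. *)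

(* Defs.v *)
From Stdlib Require Import Reals.
From Coquelicot Require Import Coquelicot.
Open Scope R_scope.

(* R^3 as an iterated product; E13 carries Coquelicot's product normed-module
   structure, whose (Euclidean) topology is the one used for derivatives and
   integrals of curves. *)
Definition E13 : NormedModule R_AbsRing :=
  prod_NormedModule R_AbsRing
    (prod_NormedModule R_AbsRing R_NormedModule R_NormedModule) R_NormedModule.

Definition vec (a b c : R) : E13 := (a, b, c).
Definition x1 (v : E13) : R := fst (fst v).
Definition x2 (v : E13) : R := snd (fst v).
Definition x3 (v : E13) : R := snd v.
Definition e3 : E13 := vec 0 0 1.

Definition g (u v : E13) : R := - (x1 u * x1 v) + x2 u * x2 v + x3 u * x3 v.
Definition lnorm (v : E13) : R := sqrt (Rabs (g v v)).

Definition spacelike (v : E13) : Prop := 0 < g v v \/ v = zero.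
Definition timelike (v : E13) : Prop := g v v < 0.

(* X and Y are linearly independent and their span is timelike, i.e. contains
   a timelike vector. *)
Definition span_timelike_plane (X Y : E13) : Prop :=
  (forall a b : R, plus (scal a X) (scal b Y) = zero -> a = 0 /\ b = 0) /\
  exists a b : R, timelike (plus (scal a X) (scal b Y)).

Definition lorentzian_timelike_angle (X Y : E13) (phi : R) : Prop :=
  spacelike X /\ spacelike Y /\ span_timelike_plane X Y /\
  0 < phi /\ Rabs (g X Y) = lnorm X * lnorm Y * cosh phi.

Definition line (q d : E13) (p : E13) : Prop :=
  exists t : R, p = plus q (scal t d).

(* Isometries of E_1^3 are the affine maps with linear part in O(1,2). *)
Definition isometry (Phi : E13 -> E13) : Prop :=
  exists (L : E13 -> E13) (c : E13),
    is_linear L /\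
    (forall u v : E13, g (L u) (L v) = g u v) /\
    (forall p : E13, Phi p = plus (L p) c).

Definition rbar_interval (a b : Rbar) (s : R) : Prop :=
  Rbar_lt a s /\ Rbar_lt s b.

Definition smooth_on (I : R -> Prop) (psi : R -> E13) : Prop :=
  forall (k : nat) (s : R), I s ->
    ex_derive_n (fun t => x1 (psi t)) k s /\
    ex_derive_n (fun t => x2 (psi t)) k s /\
    ex_derive_n (fun t => x3 (psi t)) k s.

(* Frenet apparatus of a unit speed spacelike curve with non-null principal
   normal; eps = g(N,N). The sign of kappa is not prescribed. *)
Definition frenet_apparatus (I : R -> Prop) (psi T N B : R -> E13)
    (kappa tau : R -> R) (eps : R) : Prop :=
  (eps = 1 \/ eps = -1) /\
  forall s : R, I s ->
    is_derive psi s (T s) /\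
    g (T s) (T s) = 1 /\ g (N s) (N s) = eps /\ g (B s) (B s) = - eps /\
    g (T s) (N s) = 0 /\ g (T s) (B s) = 0 /\ g (N s) (B s) = 0 /\
    is_derive T s (scal (kappa s) (N s)) /\
    is_derive N s (plus (scal (- eps * kappa s) (T s)) (scal (tau s) (B s))) /\
    is_derive B s (scal (tau s) (N s)).

(* F is an indefinite integral of f on the interval I; the constant of
   integration is the arbitrary value of F at a base point. *)
Definition indefinite_integral {V : NormedModule R_AbsRing} (I : R -> Prop)
    (f F : R -> V) : Prop :=
  forall s0 s : R, I s0 -> I s -> is_RInt f s0 s (minus (F s) (F s0)).

Definition image (I : R -> Prop) (f : R -> R) (t : R) : Prop :=
  exists s : R, I s /\ f s = t.

(* Main.v *)
Require Import Defs.
From Stdlib Require Import Reals Lra Ranalysis5 ClassicalEpsilon.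
From Coquelicot Require Import Coquelicot.
Open Scope R_scope.

(** The axis has a unit direction [U] with [g(T,U) = n] along the whole curve:
    [g(T,d)] has constant nonzero absolute value, hence constant sign, and [U]
    is [d] divided by a suitably signed length ([helix_unit_axis]).
    Differentiating [g(T,U) = n] gives [kappa * g(N,U) = 0], so the normal is
    orthogonal to the axis.

    At a base point [s0] the vectors [(T - n U) / sqrt (n^2 - 1)], [N] and [U]
    form an orthonormal frame whose only timelike member comes first, and taking
    coordinates in it is a linear isometry [L] sending [U] to [e3]
    ([adapted_isometry]). There [T] becomes [(sqrt (n^2 - 1), 0, n)] and [N]
    becomes [(0, 1, 0)], which fixes the signs in the formula. Along the curve
    [L T] stays in the plane [x3 = n] on the branch [x1 > 0] of the hyperbola
    [x1^2 - x2^2 = n^2 - 1], and [L N] is tangent to that hyperbola with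
    [x2 > 0]. The hyperbolic angle of [L T] therefore has derivative
    [kappa / sqrt (n^2 - 1) = sqrt (m^2 - 1) * kappa], which is what identifies
    it with [sqrt (m^2 - 1) * theta] for a primitive [theta] of [kappa]
    ([hyperbolic_angle]). This writes [L T] in the required form, and
    integrating the derivative [L T] of [L psi] gives the natural
    representation.

    For the parametric one, smoothness makes [kappa] continuous, so it keeps its
    sign and [theta] is strictly monotone; its inverse [sigma] has derivative
    [1 / kappa] ([is_derive_inverse_primitive]), and the chain rule gives the
    derivative of [L psi(sigma t)]. *)

(** * The Lorentzian form and coordinates in an orthonormal frame *)

Lemma g_sym (u v : E13) : g u v = g v u.
Proof. unfold g; ring. Qed.

Lemma g_plus_l (u v w : E13) : g (plus u v) w = g u w + g v w.
Proof.
  destruct u as [[u1 u2] u3], v as [[v1 v2] v3], w as [[w1 w2] w3].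
  unfold g, x1, x2, x3; simpl; unfold plus; simpl; ring.
Qed.

Lemma g_scal_l (k : R) (u w : E13) : g (scal k u) w = k * g u w.
Proof.
  destruct u as [[u1 u2] u3], w as [[w1 w2] w3].
  unfold g, x1, x2, x3; simpl; unfold scal, mult; simpl; unfold mult; simpl; ring.
Qed.

Lemma g_plus_r (u v w : E13) : g w (plus u v) = g w u + g w v.
Proof. rewrite g_sym, g_plus_l, (g_sym u), (g_sym v); reflexivity. Qed.

Lemma g_scal_r (k : R) (u w : E13) : g w (scal k u) = k * g w u.
Proof. rewrite g_sym, g_scal_l, (g_sym u); reflexivity. Qed.

Lemma g_e3 (v : E13) : g v e3 = x3 v.
Proof. unfold g, e3, vec, x1, x2, x3; simpl; ring. Qed.

Lemma E13_ext (u v : E13) : x1 u = x1 v -> x2 u = x2 v -> x3 u = x3 v -> u = v.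
Proof.
  destruct u as [[u1 u2] u3], v as [[v1 v2] v3]; unfold x1, x2, x3; simpl.
  intros -> -> ->; reflexivity.
Qed.

(** Composing the pairing with the sum transports also the norm bound that
    [is_linear] carries. *)
Lemma is_linear_add {U : NormedModule R_AbsRing} (l1 l2 : U -> R) :
  is_linear l1 -> is_linear l2 -> is_linear (fun v => l1 v + l2 v).
Proof.
  intros h1 h2.
  exact (is_linear_comp _ _ (is_linear_prod _ _ h1 h2)
           (@is_linear_plus R_AbsRing R_NormedModule)).
Qed.

Lemma is_linear_mul {U : NormedModule R_AbsRing} (k : R) (l : U -> R) :
  is_linear l -> is_linear (fun v => k * l v).
Proof.
  intros h.
  exact (is_linear_comp l _ h
           (@is_linear_scal_r R_AbsRing R_NormedModule k Rmult_comm)).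
Qed.

Lemma is_linear_x1 : is_linear (x1 : E13 -> R).
Proof.
  exact (is_linear_comp _ _ is_linear_fst is_linear_fst).
Qed.

Lemma is_linear_x2 : is_linear (x2 : E13 -> R).
Proof.
  exact (is_linear_comp _ _ is_linear_fst is_linear_snd).
Qed.

Lemma is_linear_x3 : is_linear (x3 : E13 -> R).
Proof. exact is_linear_snd. Qed.

Lemma is_linear_g (w : E13) : is_linear (fun v => g v w).
Proof.
  assert (e : forall v : E13,
            (- x1 w * x1 v + x2 w * x2 v) + x3 w * x3 v = g v w)
    by (intros v; unfold g; ring).
  refine (is_linear_ext _ _ e _).
  repeat apply is_linear_add; apply is_linear_mul;
    [apply is_linear_x1 | apply is_linear_x2 | apply is_linear_x3].
Qed.

Definition lorentz_orthonormal (E1 E2 E3 : E13) : Prop :=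
  g E1 E1 = -1 /\ g E2 E2 = 1 /\ g E3 E3 = 1 /\
  g E1 E2 = 0 /\ g E1 E3 = 0 /\ g E2 E3 = 0.

(** The sign in the first slot makes these the coefficients of [v] in the
    frame, because [E1] is timelike. *)
Definition frame_coords (E1 E2 E3 v : E13) : E13 :=
  vec (- g v E1) (g v E2) (g v E3).

Lemma is_linear_frame_coords (E1 E2 E3 : E13) :
  is_linear (frame_coords E1 E2 E3).
Proof.
  apply (is_linear_prod (fun v : E13 => (- g v E1, g v E2)) (fun v => g v E3)).
  2: apply is_linear_g.
  apply (is_linear_prod (fun v : E13 => - g v E1) (fun v => g v E2)).
  2: apply is_linear_g.
  assert (e : forall v : E13, (-1) * g v E1 = - g v E1) by (intros v; ring).
  refine (is_linear_ext _ _ e _).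
  apply is_linear_mul, is_linear_g.
Qed.

(** The Gram determinant of three vectors is minus the square of their
    determinant, so a Lorentz orthonormal frame has a nonzero determinant and
    Cramer's rule makes a vector orthogonal to the frame vanish. *)
Lemma orthogonal_to_frame_eq0 (E1 E2 E3 w : E13) :
  lorentz_orthonormal E1 E2 E3 ->
  g w E1 = 0 -> g w E2 = 0 -> g w E3 = 0 -> w = zero.
Proof.
  destruct E1 as [[a1 a2] a3], E2 as [[b1 b2] b3], E3 as [[c1 c2] c3],
    w as [[w1 w2] w3].
  unfold lorentz_orthonormal, g, x1, x2, x3; simpl.
  intros (h11 & h22 & h33 & h12 & h13 & h23) h1 h2 h3.
  set (D := a1 * (b2 * c3 - b3 * c2) - a2 * (b1 * c3 - b3 * c1)
            + a3 * (b1 * c2 - b2 * c1)).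
  assert (hD : D * D = 1).
  { transitivity
     (- ((- (a1 * a1) + a2 * a2 + a3 * a3)
           * ((- (b1 * b1) + b2 * b2 + b3 * b3)
                * (- (c1 * c1) + c2 * c2 + c3 * c3)
              - (- (b1 * c1) + b2 * c2 + b3 * c3)
                * (- (b1 * c1) + b2 * c2 + b3 * c3))
         - (- (a1 * b1) + a2 * b2 + a3 * b3)
           * ((- (a1 * b1) + a2 * b2 + a3 * b3)
                * (- (c1 * c1) + c2 * c2 + c3 * c3)
              - (- (b1 * c1) + b2 * c2 + b3 * c3)
                * (- (a1 * c1) + a2 * c2 + a3 * c3))
         + (- (a1 * c1) + a2 * c2 + a3 * c3)
           * ((- (a1 * b1) + a2 * b2 + a3 * b3)
                * (- (b1 * c1) + b2 * c2 + b3 * c3)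
              - (- (b1 * b1) + b2 * b2 + b3 * b3)
                * (- (a1 * c1) + a2 * c2 + a3 * c3)))).
    - unfold D; ring.
    - rewrite h11, h22, h33, h12, h13, h23; ring. }
  assert (hD0 : D <> 0) by (intros h0; rewrite h0 in hD; lra).
  assert (w1_0 : w1 = 0).
  { apply (Rmult_eq_reg_l D); [|exact hD0]; rewrite Rmult_0_r.
    transitivity (- ((- (w1 * a1) + w2 * a2 + w3 * a3) * (b2 * c3 - b3 * c2)
      - (- (w1 * b1) + w2 * b2 + w3 * b3) * (a2 * c3 - a3 * c2)
      + (- (w1 * c1) + w2 * c2 + w3 * c3) * (a2 * b3 - a3 * b2))).
    - unfold D; ring.
    - rewrite h1, h2, h3; ring. }
  assert (w2_0 : w2 = 0).
  { apply (Rmult_eq_reg_l D); [|exact hD0]; rewrite Rmult_0_r.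
    transitivity (- ((- (w1 * a1) + w2 * a2 + w3 * a3) * (b1 * c3 - b3 * c1)
      - (- (w1 * b1) + w2 * b2 + w3 * b3) * (a1 * c3 - a3 * c1)
      + (- (w1 * c1) + w2 * c2 + w3 * c3) * (a1 * b3 - a3 * b1))).
    - unfold D; ring.
    - rewrite h1, h2, h3; ring. }
  assert (w3_0 : w3 = 0).
  { apply (Rmult_eq_reg_l D); [|exact hD0]; rewrite Rmult_0_r.
    transitivity ((- (w1 * a1) + w2 * a2 + w3 * a3) * (b1 * c2 - b2 * c1)
      - (- (w1 * b1) + w2 * b2 + w3 * b3) * (a1 * c2 - a2 * c1)
      + (- (w1 * c1) + w2 * c2 + w3 * c3) * (a1 * b2 - a2 * b1)).
    - unfold D; ring.
    - rewrite h1, h2, h3; ring. }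
  subst; reflexivity.
Qed.

(** The difference of the two sides is orthogonal to the frame. *)
Lemma frame_expansion (E1 E2 E3 v : E13) :
  lorentz_orthonormal E1 E2 E3 ->
  v = plus (plus (scal (- g v E1) E1) (scal (g v E2) E2)) (scal (g v E3) E3).
Proof.
  intros ho; pose proof ho as (h11 & h22 & h33 & h12 & h13 & h23).
  set (p := plus (plus _ _) _).
  assert (h0 : plus v (scal (-1) p) = zero).
  { apply (orthogonal_to_frame_eq0 E1 E2 E3); auto; unfold p;
      rewrite !g_plus_l, !g_scal_l, !g_plus_l, !g_scal_l,
        ?(g_sym E2 E1), ?(g_sym E3 E1), ?(g_sym E3 E2),
        ?h11, ?h22, ?h33, ?h12, ?h13, ?h23; ring. }
  change (scal (-1) p) with (scal (opp one : R_AbsRing) p) in h0.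
  rewrite scal_opp_one in h0.
  apply (plus_reg_r (opp p)); rewrite plus_opp_r; exact h0.
Qed.

Lemma frame_coords_isometric (E1 E2 E3 u v : E13) :
  lorentz_orthonormal E1 E2 E3 ->
  g (frame_coords E1 E2 E3 u) (frame_coords E1 E2 E3 v) = g u v.
Proof.
  intros ho.
  rewrite (frame_expansion E1 E2 E3 v ho) at 2.
  rewrite !g_plus_r, !g_scal_r.
  unfold frame_coords, g at 1, vec, x1, x2, x3; simpl; ring.
Qed.

(** The form is nondegenerate, hence a map preserving it is injective. *)
Lemma isometric_injective (L : E13 -> E13) :
  is_linear L -> (forall u v : E13, g (L u) (L v) = g u v) ->
  forall u v : E13, L u = L v -> u = v.
Proof.
  intros hL hg u v huv.
  assert (H : forall w, g u w = g v w)
    by (intros w; rewrite <- (hg u), <- (hg v), huv; reflexivity).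
  pose proof (H (vec 1 0 0)) as H1.
  pose proof (H (vec 0 1 0)) as H2.
  pose proof (H (vec 0 0 1)) as H3.
  unfold g in H1, H2, H3; cbn [x1 x2 x3 vec fst snd] in H1, H2, H3.
  apply E13_ext; unfold vec, x1, x2, x3 in *; simpl in *; lra.
Qed.

(** Injectivity gives the converse inclusion: a point whose image is on the image
    line was on the line. *)
Lemma line_linear_image (L : E13 -> E13) (q d U : E13) (r : R) :
  is_linear L -> (forall u v : E13, g (L u) (L v) = g u v) ->
  r <> 0 -> d = scal r U -> L U = e3 ->
  forall p : E13, line q d p <-> line (L q) e3 (L p).
Proof.
  intros hL hg hr hd hU p; subst d; split.
  - intros [t ->]; exists (t * r).
    rewrite (linear_plus _ hL), !(linear_scal _ hL), hU.
    rewrite scal_assoc; reflexivity.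
  - intros [t ht]; exists (t / r).
    apply (isometric_injective L hL hg); rewrite ht.
    rewrite (linear_plus _ hL), !(linear_scal _ hL), hU.
    rewrite scal_assoc; f_equal; f_equal.
    unfold mult; simpl; field; exact hr.
Qed.

(** * One-variable calculus on intervals *)

Definition interval_like (J : R -> Prop) : Prop :=
  forall x y z : R, J x -> J z -> x <= y <= z -> J y.

Lemma interval_like_between (J : R -> Prop) (x y z : R) :
  interval_like J -> J x -> J z -> Rmin x z <= y <= Rmax x z -> J y.
Proof.
  intros hJ hx hz hy.
  destruct (Rle_dec x z) as [h|h].
  - rewrite Rmin_left, Rmax_right in hy by lra; exact (hJ x y z hx hz hy).
  - rewrite Rmin_right, Rmax_left in hy by lra; exact (hJ z y x hz hx hy).
Qed.

Lemma interval_like_rbar (a b : Rbar) : interval_like (rbar_interval a b).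
Proof.
  intros x y z [hx _] [_ hz] [hxy hyz]; split.
  - exact (Rbar_lt_le_trans a x y hx hxy).
  - exact (Rbar_le_lt_trans y z b hyz hz).
Qed.

Lemma locally_rbar_interval (a b : Rbar) (s : R) :
  rbar_interval a b s -> locally s (rbar_interval a b).
Proof.
  intros [h1 h2]; apply (locally_interval _ s a b h1 h2).
  intros y hy1 hy2; split; assumption.
Qed.

Lemma rbar_interval_nonempty (a b : Rbar) :
  Rbar_lt a b -> exists s : R, rbar_interval a b s.
Proof.
  destruct a as [a| |], b as [b| |]; simpl; intros h; try contradiction.
  - exists ((a + b) / 2); split; simpl; lra.
  - exists (a + 1); split; simpl; [lra | exact I].
  - exists (b - 1); split; simpl; [exact I | lra].
  - exists 0; split; exact I.
Qed.

(** The endpoints come in either order, as the two places where [f] is small and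
    large may. *)
Lemma IVT_on (J : R -> Prop) (f : R -> R) (x y v : R) :
  interval_like J -> (forall s, J s -> continuous f s) ->
  J x -> J y -> f x <= v <= f y ->
  exists z, Rmin x y <= z <= Rmax x y /\ f z = v.
Proof.
  intros hJ hf hx hy [h1 h2].
  assert (hc : forall z, Rmin x y <= z <= Rmax x y -> continuity_pt f z).
  { intros z hz; apply continuity_pt_filterlim, hf.
    exact (interval_like_between J x z y hJ hx hy hz). }
  pose proof (Rmin_l x y); pose proof (Rmin_r x y).
  pose proof (Rmax_l x y); pose proof (Rmax_r x y).
  destruct h1 as [h1|h1]; [|exists x; split; [lra | exact h1]].
  destruct h2 as [h2|h2]; [|exists y; split; [lra | now symmetry]].
  destruct (Rtotal_order x y) as [h|[h|h]].
  - destruct (IVT_interv (fun t => f t - v) x y) as (z & hz & ez); try lra.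
    + intros t ht; apply continuity_pt_minus.
      * apply hc; lra.
      * apply continuity_pt_const; intros ? ?; reflexivity.
    + exists z; split; lra.
  - subst; lra.
  - destruct (IVT_interv (fun t => v - f t) y x) as (z & hz & ez); try lra.
    + intros t ht; apply continuity_pt_minus.
      * apply continuity_pt_const; intros ? ?; reflexivity.
      * apply hc; lra.
    + exists z; split; lra.
Qed.

Lemma nonvanishing_same_sign (J : R -> Prop) (f : R -> R) (x y : R) :
  interval_like J -> (forall s, J s -> continuous f s) ->
  (forall s, J s -> f s <> 0) ->
  J x -> J y -> 0 < f x * f y.
Proof.
  intros hJ hc h0 hx hy.
  assert (hno : forall u v, J u -> J v -> f u <= 0 <= f v -> False).
  { intros u v hu hv huv.
    destruct (IVT_on J f u v 0 hJ hc hu hv huv) as (z & hz & ez).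
    exact (h0 z (interval_like_between J u z v hJ hu hv hz) ez). }
  pose proof (h0 x hx); pose proof (h0 y hy).
  destruct (Rlt_dec (f x) 0) as [a|a], (Rlt_dec (f y) 0) as [b|b].
  - nra.
  - exfalso; apply (hno x y hx hy); lra.
  - exfalso; apply (hno y x hy hx); lra.
  - apply Rmult_lt_0_compat; lra.
Qed.

Lemma indefinite_integral_of_derivative (J : R -> Prop) (f F : R -> R) :
  interval_like J ->
  (forall s, J s -> is_derive F s (f s)) ->
  (forall s, J s -> continuous f s) ->
  indefinite_integral (V := R_NormedModule) J f F.
Proof.
  intros hJ hd hc s0 s h0 h.
  apply (is_RInt_derive (V := R_CompleteNormedModule) F f); intros t ht.
  - apply hd, (interval_like_between J s0 t s); assumption.
  - apply hc, (interval_like_between J s0 t s); assumption.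
Qed.

(** Integration in [E13] is coordinatewise, which reduces the fundamental theorem
    of calculus for curves to real functions. *)
Lemma indefinite_integral_coords (J : R -> Prop) (f F : R -> E13) :
  indefinite_integral (V := R_NormedModule) J
    (fun s => x1 (f s)) (fun s => x1 (F s)) ->
  indefinite_integral (V := R_NormedModule) J
    (fun s => x2 (f s)) (fun s => x2 (F s)) ->
  indefinite_integral (V := R_NormedModule) J
    (fun s => x3 (f s)) (fun s => x3 (F s)) ->
  indefinite_integral J f F.
Proof.
  intros h1 h2 h3 s0 s hs0 hs.
  specialize (h1 s0 s hs0 hs); specialize (h2 s0 s hs0 hs);
    specialize (h3 s0 s hs0 hs).
  exact (is_RInt_fct_extend_pair
           (U := prod_NormedModule R_AbsRing R_NormedModule R_NormedModule)
           (V := R_NormedModule) f s0 s _ _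
           (is_RInt_fct_extend_pair (U := R_NormedModule) (V := R_NormedModule)
              (fun t => fst (f t)) s0 s _ _ h1 h2) h3).
Qed.

Lemma is_derive_linear {V W : NormedModule R_AbsRing} (l : V -> W)
  (f : R -> V) (s : R) (v : V) :
  is_linear l -> is_derive f s v -> is_derive (fun t => l (f t)) s (l v).
Proof.
  intros hl hf.
  apply (filterdiff_ext_lin _ (fun y : R => l (scal y v))).
  - apply (filterdiff_comp' f l s (fun y => scal y v) l hf).
    apply filterdiff_linear, hl.
  - intros y; apply (linear_scal l hl).
Qed.

Lemma is_derive_continuous (f : R -> R) (s v : R) :
  is_derive f s v -> continuous f s.
Proof. intros h; apply (ex_derive_continuous f s); exists v; exact h. Qed.

(** Differentiability of order three is what makes a second derivative
    continuous; [f1] and [f2] agree with the iterated derivatives only on the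
    open interval, hence locally. *)
Lemma second_derivative_continuous (a b : Rbar) (f f1 f2 : R -> R) :
  (forall s, rbar_interval a b s -> is_derive f s (f1 s)) ->
  (forall s, rbar_interval a b s -> is_derive f1 s (f2 s)) ->
  (forall s, rbar_interval a b s -> ex_derive_n f 3 s) ->
  forall s, rbar_interval a b s -> continuous f2 s.
Proof.
  intros h1 h2 h3.
  assert (e2 : forall s, rbar_interval a b s -> Derive_n f 2 s = f2 s).
  { intros s hs; simpl.
    rewrite (Derive_ext_loc _ f1).
    - apply is_derive_unique, h2, hs.
    - apply (filter_imp (rbar_interval a b)).
      + intros t ht; apply is_derive_unique, h1, ht.
      + apply locally_rbar_interval, hs. }
  intros s hs.
  apply (continuous_ext_loc f2 (Derive_n f 2)).
  - apply (filter_imp (rbar_interval a b)); [exact e2|].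
    apply locally_rbar_interval, hs.
  - apply (ex_derive_continuous (Derive_n f 2)), (h3 s hs).
Qed.

(** * Inverting a primitive of a nonvanishing function *)

Section InversePrimitive.

Variables (a b : Rbar) (theta kappa : R -> R).
Hypothesis htheta : forall s, rbar_interval a b s -> is_derive theta s (kappa s).
Hypothesis hkappa : forall s, rbar_interval a b s -> continuous kappa s.
Hypothesis hkappa0 : forall s, rbar_interval a b s -> kappa s <> 0.

Let I := rbar_interval a b.

(** Multiplying by the value of [kappa] at a base point turns [theta] into an
    increasing function whatever the sign of [kappa]. *)
Lemma primitive_increasing (s0 x y : R) :
  I s0 -> I x -> I y -> x < y -> kappa s0 * theta x < kappa s0 * theta y.
Proof.
  intros h0 hx hy hxy.
  apply (incr_function (fun s => kappa s0 * theta s) a b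
           (fun s => kappa s0 * kappa s)).
  - intros s h1 h2; apply is_derive_scal, htheta; split; assumption.
  - intros s h1 h2; apply Rlt_gt, (nonvanishing_same_sign I); auto.
    + apply interval_like_rbar.
    + split; assumption.
  - apply hx.
  - exact hxy.
  - apply hy.
Qed.

Lemma primitive_injective (x y : R) : I x -> I y -> theta x = theta y -> x = y.
Proof.
  intros hx hy h.
  destruct (Rtotal_order x y) as [l|[l|l]]; [|exact l|].
  - pose proof (primitive_increasing x x y hx hx hy l); rewrite h in *; lra.
  - pose proof (primitive_increasing x y x hx hy hx l); rewrite h in *; lra.
Qed.

Lemma primitive_continuous (s : R) : I s -> continuous theta s.
Proof. intros hs; exact (is_derive_continuous _ _ _ (htheta s hs)). Qed.

(** A strictly monotone continuous function maps a small interval around [s]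
    onto a neighbourhood of its value there. *)
Lemma primitive_locally_onto (s eps : R) : I s -> 0 < eps ->
  locally (theta s) (fun t => exists u, Rabs (u - s) < eps /\ I u /\ theta u = t).
Proof.
  intros hs he.
  destruct (Rbar_lt_locally a b s (proj1 hs) (proj2 hs)) as [del hdel].
  pose proof (cond_pos del) as hdp.
  set (r := Rmin eps del / 2).
  assert (hr : 0 < r /\ r < eps /\ r < del).
  { unfold r; pose proof (Rmin_l eps del); pose proof (Rmin_r eps del).
    assert (0 < Rmin eps del) by (apply Rmin_glb_lt; assumption); lra. }
  assert (hl : I (s - r)) by (apply hdel; apply Rabs_def1; lra).
  assert (hu : I (s + r)) by (apply hdel; apply Rabs_def1; lra).
  set (w := kappa s).
  assert (hw : w <> 0) by (apply hkappa0, hs).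
  assert (hwp : 0 < Rabs w) by (apply Rabs_pos_lt, hw).
  assert (h1 : w * theta (s - r) < w * theta s)
    by (apply primitive_increasing; auto; lra).
  assert (h2 : w * theta s < w * theta (s + r))
    by (apply primitive_increasing; auto; lra).
  set (m := Rmin (w * theta s - w * theta (s - r))
                 (w * theta (s + r) - w * theta s)).
  assert (hm : 0 < m) by (apply Rmin_glb_lt; lra).
  assert (hm1 : m <= w * theta s - w * theta (s - r)) by apply Rmin_l.
  assert (hm2 : m <= w * theta (s + r) - w * theta s) by apply Rmin_r.
  assert (hq : 0 < m / Rabs w) by (apply Rdiv_lt_0_compat; assumption).
  exists (mkposreal _ hq); intros t ht.
  change (Rabs (t - theta s) < m / Rabs w) in ht.
  assert (hwt : Rabs (w * t - w * theta s) < m).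
  { rewrite <- Rmult_minus_distr_l, Rabs_mult.
    apply (Rmult_lt_compat_l (Rabs w)) in ht; [|exact hwp].
    replace (Rabs w * (m / Rabs w)) with m in ht by (field; lra); exact ht. }
  apply Rabs_def2 in hwt.
  destruct (IVT_on I (fun x => w * theta x) (s - r) (s + r) (w * t))
    as (u & hu1 & hu2); auto.
  - apply interval_like_rbar.
  - intros x hx; apply (is_derive_continuous _ x (w * kappa x)).
    apply is_derive_scal, htheta, hx.
  - lra.
  - rewrite Rmin_left, Rmax_right in hu1 by lra.
    exists u; split; [apply Rabs_def1; lra | split].
    + exact (interval_like_rbar a b (s - r) u (s + r) hl hu hu1).
    + exact (Rmult_eq_reg_l w _ _ hu2 hw).
Qed.

Lemma image_primitive_interval_like : interval_like (image I theta).
Proof.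
  intros x y z (s & hs & <-) (u & hu & <-) hy.
  destruct (IVT_on I theta s u y (interval_like_rbar a b) primitive_continuous
              hs hu hy) as (v & hv & <-).
  exists v; split; [|reflexivity].
  exact (interval_like_between I s v u (interval_like_rbar a b) hs hu hv).
Qed.

Variable sigma : R -> R.
Hypothesis hsigma : forall s, I s -> sigma (theta s) = s.

Lemma inverse_primitive_continuous (s : R) : I s -> continuous sigma (theta s).
Proof.
  intros hs; apply continuity_pt_filterlim, continuity_pt_locally; intros eps.
  apply (filter_imp (fun t => exists u,
           Rabs (u - s) < eps /\ I u /\ theta u = t)).
  - intros t (u & hu & hIu & <-); rewrite !hsigma by assumption; exact hu.
  - apply primitive_locally_onto; [exact hs | apply cond_pos].
Qed.

(** The difference quotient of the inverse is the reciprocal of a difference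
    quotient of [theta] whose increment is small by continuity of the inverse. *)
Lemma is_derive_inverse_primitive (s : R) :
  I s -> is_derive sigma (theta s) (/ kappa s).
Proof.
  intros hs; apply is_derive_Reals; intros eps he.
  set (k := kappa s).
  assert (hk : k <> 0) by (apply hkappa0, hs).
  assert (hkp : 0 < Rabs k) by (apply Rabs_pos_lt, hk).
  (* |q - k| < e' forces |q| > |k|/2, so |1/q - 1/k| < 2 e' / k^2. *)
  set (e' := Rmin (Rabs k / 2) (eps * (Rabs k / 2 * Rabs k))).
  assert (he' : 0 < e').
  { apply Rmin_glb_lt; [lra|].
    repeat apply Rmult_lt_0_compat; lra. }
  assert (he1 : e' <= Rabs k / 2) by apply Rmin_l.
  assert (he2 : e' <= eps * (Rabs k / 2 * Rabs k)) by apply Rmin_r.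
  destruct (proj1 (is_derive_Reals _ _ _) (htheta s hs) e' he') as [del hdel].
  destruct (primitive_locally_onto s del hs (cond_pos del)) as [eta heta].
  exists eta; intros h h0 hh.
  destruct (heta (theta s + h)) as (u & hu & hIu & eu).
  { change (Rabs (theta s + h - theta s) < eta).
    replace (theta s + h - theta s) with h by ring; exact hh. }
  rewrite <- eu, !hsigma by assumption.
  assert (hus : u - s <> 0).
  { intros h1; assert (u = s) by lra; subst u; lra. }
  specialize (hdel (u - s) hus hu).
  replace (s + (u - s)) with u in hdel by ring.
  replace (theta u - theta s) with h in hdel by lra.
  fold k in hdel |- *.
  set (q := h / (u - s)) in *.
  assert (hq : Rabs k / 2 < Rabs q).
  { pose proof (Rabs_triang_inv k q); rewrite Rabs_minus_sym in hdel; lra. }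
  assert (hq0 : q <> 0) by (intros h1; rewrite h1, Rabs_R0 in hq; lra).
  replace ((u - s) / h - / k) with (- (q - k) / (q * k))
    by (unfold q; field; repeat split; auto).
  rewrite Rabs_div by (apply Rmult_integral_contrapositive_currified; auto).
  rewrite Rabs_Ropp, Rabs_mult.
  assert (hqk : 0 < Rabs q * Rabs k) by (apply Rmult_lt_0_compat; lra).
  apply (Rmult_lt_reg_r (Rabs q * Rabs k)); [exact hqk|].
  unfold Rdiv; rewrite Rmult_assoc, Rinv_l, Rmult_1_r by lra.
  apply Rlt_le_trans with (1 := hdel), Rle_trans with (1 := he2).
  apply Rmult_le_compat_l; [lra|].
  apply Rmult_le_compat_r; lra.
Qed.

End InversePrimitive.

(** * The tangent in coordinates adapted to the axis *)

Lemma cosh_sq (x : R) : cosh x * cosh x = 1 + sinh x * sinh x.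
Proof.
  unfold cosh, sinh; rewrite exp_Ropp; pose proof (exp_pos x); field; lra.
Qed.

Lemma cosh_pos (x : R) : 0 < cosh x.
Proof. unfold cosh; pose proof (exp_pos x); pose proof (exp_pos (- x)); lra. Qed.

Lemma cosh_gt_1 (x : R) : 0 < x -> 1 < cosh x.
Proof.
  intros hx; pose proof (cosh_pos x); pose proof (cosh_sq x).
  assert (0 < sinh x)
    by (unfold sinh; pose proof (exp_increasing (- x) x ltac:(lra)); lra).
  nra.
Qed.

Lemma cosh_arcsinh (y : R) : cosh (arcsinh y) = sqrt (y ^ 2 + 1).
Proof.
  symmetry; apply sqrt_lem_1; [nra | left; apply cosh_pos |].
  rewrite cosh_sq, sinh_arcsinh; ring.
Qed.

Lemma helix_constants (n m : R) : 1 < n -> m = n / sqrt (n ^ 2 - 1) ->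
  0 < sqrt (n ^ 2 - 1) /\ sqrt (n ^ 2 - 1) * sqrt (n ^ 2 - 1) = n ^ 2 - 1 /\
  sqrt (n ^ 2 - 1) * m = n /\ sqrt (m ^ 2 - 1) = / sqrt (n ^ 2 - 1).
Proof.
  intros hn hm.
  assert (h : 0 < n ^ 2 - 1) by nra.
  set (c := sqrt (n ^ 2 - 1)) in *.
  assert (hc : 0 < c) by (apply sqrt_lt_R0, h).
  assert (hcc : c * c = n ^ 2 - 1) by (apply sqrt_sqrt; lra).
  repeat split; auto.
  - rewrite hm; field; lra.
  - replace (m ^ 2 - 1) with (/ c * / c).
    + apply sqrt_square; left; apply Rinv_0_lt_compat, hc.
    + rewrite hm; apply (Rmult_eq_reg_r (c * c)); [|nra].
      transitivity (n ^ 2 - c * c); [|field; lra].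
      rewrite hcc at 2; field; lra.
Qed.

(** [X] is a tangent and [Y] a normal. Since [x1 X > 0], [X] moves on one branch
    of the hyperbola [x1^2 - x2^2 = c^2] in the plane [x3 = n], where the
    hyperbolic angle is [arcsinh (x2 X / c)]. A unit vector of that plane's
    direction orthogonal to [X] is [(x2 X, x1 X, 0) / c] up to sign, and
    [x2 Y > 0] selects the sign; hence [x2 X] has derivative
    [kappa * x1 X / c], and the angle has derivative [kappa / c]. *)
Lemma hyperbolic_angle (I : R -> Prop) (X Y : R -> E13) (kappa : R -> R)
  (n c : R) :
  0 < c -> c * c = n ^ 2 - 1 ->
  (forall s, I s -> is_derive X s (scal (kappa s) (Y s))) ->
  (forall s, I s -> g (X s) (X s) = 1) ->
  (forall s, I s -> g (Y s) (Y s) = 1) ->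
  (forall s, I s -> g (X s) (Y s) = 0) ->
  (forall s, I s -> x3 (X s) = n) -> (forall s, I s -> x3 (Y s) = 0) ->
  (forall s, I s -> 0 < x1 (X s)) -> (forall s, I s -> 0 < x2 (Y s)) ->
  exists theta : R -> R, forall s, I s ->
    is_derive theta s (kappa s) /\
    x1 (X s) = c * cosh (/ c * theta s) /\
    x2 (X s) = c * sinh (/ c * theta s).
Proof.
  intros hc hcc hX hXX hYY hXY hX3 hY3 hX1 hY2.
  exists (fun s => c * arcsinh (x2 (X s) / c)); intros s hs.
  specialize (hX s hs); specialize (hXX s hs); specialize (hYY s hs).
  specialize (hXY s hs); specialize (hX3 s hs); specialize (hY3 s hs).
  specialize (hX1 s hs); specialize (hY2 s hs).
  unfold g in hXX, hYY, hXY; rewrite hX3 in hXX, hXY; rewrite hY3 in hYY, hXY.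
  pose proof (is_derive_linear _ _ _ _ is_linear_x2 hX) as hd.
  rewrite (linear_scal _ is_linear_x2) in hd.
  change (is_derive (fun t => x2 (X t)) s (kappa s * x2 (Y s))) in hd.
  set (X1 := x1 (X s)) in *; set (X2 := x2 (X s)) in *.
  set (Y1 := x1 (Y s)) in *; set (Y2 := x2 (Y s)) in *.
  assert (hroot : sqrt ((X2 / c) ^ 2 + 1) = X1 / c).
  { apply sqrt_lem_1.
    - pose proof (pow2_ge_0 (X2 / c)); lra.
    - left; apply Rdiv_lt_0_compat; assumption.
    - replace ((X2 / c) ^ 2 + 1) with ((X2 * X2 + c * c) / (c * c))
        by (field; lra).
      replace (X2 * X2 + c * c) with (X1 * X1) by nra.
      field; lra. }
  assert (hY : c * Y2 = X1).
  { assert (hsq : (c * Y2) * (c * Y2) = X1 * X1).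
    { assert (h1 : X1 * Y1 = X2 * Y2) by lra.
      assert (h2 : X1 * X1 * (Y2 * Y2) = X1 * X1 + X2 * Y2 * (X2 * Y2)).
      { rewrite <- h1; nra. }
      nra. }
    assert (0 < c * Y2) by (apply Rmult_lt_0_compat; assumption).
    nra. }
  replace (/ c * (c * arcsinh (X2 / c))) with (arcsinh (X2 / c))
    by (field; lra).
  split; [|split].
  - replace (kappa s) with (c * ((kappa s * Y2 * / c) * / (X1 / c))).
    + apply is_derive_scal.
      apply (is_derive_comp arcsinh (fun t => x2 (X t) / c) s
               (/ (X1 / c)) (kappa s * Y2 * / c)).
      * rewrite <- hroot; apply is_derive_Reals, derivable_pt_lim_arcsinh.
      * apply (is_derive_ext (fun t => / c * x2 (X t))).
        { intros t; apply Rmult_comm. }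
        rewrite Rmult_comm; apply is_derive_scal, hd.
    + rewrite <- hY; field; nra.
  - rewrite cosh_arcsinh, hroot; field; lra.
  - rewrite sinh_arcsinh; field; lra.
Qed.

(** [g(T,d)] keeps a constant absolute value, and a sign by continuity, so it is
    constant; dividing [d] by the signed length that makes this constant equal
    to [n] gives the unit direction of the axis. Differentiating shows that the
    normal is orthogonal to it. *)
Lemma helix_unit_axis (a b : Rbar) (T N : R -> E13) (kappa : R -> R)
  (d : E13) (phi n : R) :
  Rbar_lt a b ->
  (forall s, rbar_interval a b s -> is_derive T s (scal (kappa s) (N s))) ->
  (forall s, rbar_interval a b s -> g (T s) (T s) = 1) ->
  (forall s, rbar_interval a b s -> kappa s <> 0) ->
  spacelike d -> d <> zero ->
  (forall s, rbar_interval a b s -> lorentzian_timelike_angle (T s) d phi) ->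
  n = cosh phi ->
  1 < n /\
  exists (r : R) (U : E13), r <> 0 /\ d = scal r U /\ g U U = 1 /\
    forall s, rbar_interval a b s -> g (T s) U = n /\ g (N s) U = 0.
Proof.
  intros hab hT hTT hk hd hd0 hangle hn.
  destruct (rbar_interval_nonempty a b hab) as [s0 hs0].
  assert (hn1 : 1 < n).
  { destruct (hangle s0 hs0) as (_ & _ & _ & hphi & _).
    rewrite hn; apply cosh_gt_1, hphi. }
  split; [exact hn1|].
  assert (hdd : 0 < g d d) by (destruct hd as [h|h]; [exact h | contradiction]).
  assert (hl : 0 < lnorm d).
  { apply sqrt_lt_R0, Rabs_pos_lt; lra. }
  assert (hll : lnorm d * lnorm d = g d d).
  { unfold lnorm; rewrite (Rabs_right (g d d)) by lra; apply sqrt_sqrt; lra. }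
  assert (habs : forall s, rbar_interval a b s ->
            Rabs (g (T s) d) = lnorm d * n).
  { intros s hs; destruct (hangle s hs) as (_ & _ & _ & _ & e).
    rewrite e, hn; unfold lnorm at 1.
    rewrite (hTT s hs), Rabs_R1, sqrt_1; ring. }
  assert (hln : 0 < lnorm d * n) by (apply Rmult_lt_0_compat; lra).
  assert (hder : forall s, rbar_interval a b s ->
            is_derive (fun t => g (T t) d) s (kappa s * g (N s) d)).
  { intros s hs.
    pose proof (is_derive_linear _ _ _ _ (is_linear_g d) (hT s hs)) as h.
    cbv beta in h; rewrite g_scal_l in h; exact h. }
  assert (hconst : forall s, rbar_interval a b s -> g (T s) d = g (T s0) d).
  { intros s hs.
    assert (hsign : 0 < g (T s) d * g (T s0) d).
    { apply (nonvanishing_same_sign (rbar_interval a b) (fun t => g (T t) d));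
        auto using interval_like_rbar.
      - intros t ht; exact (is_derive_continuous _ _ _ (hder t ht)).
      - intros t ht h0; pose proof (habs t ht) as h.
        rewrite h0, Rabs_R0 in h; lra. }
    pose proof (habs s hs) as h1; pose proof (habs s0 hs0) as h2.
    revert h1 h2; unfold Rabs; do 2 destruct Rcase_abs; nra. }
  set (r := g (T s0) d / n).
  assert (hrr : r * r = g d d).
  { rewrite <- hll; unfold r.
    pose proof (habs s0 hs0) as h.
    assert (h2 : g (T s0) d * g (T s0) d = (lnorm d * n) * (lnorm d * n)).
    { rewrite <- h, <- Rabs_mult, Rabs_right; [reflexivity | nra]. }
    transitivity ((g (T s0) d * g (T s0) d) / (n * n)); [field; lra|].
    rewrite h2; field; lra. }
  assert (hr : r <> 0) by (intros h; rewrite h in hrr; lra).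
  exists r, (scal (/ r) d); repeat split.
  - exact hr.
  - rewrite scal_assoc; unfold mult; simpl; rewrite Rinv_r by exact hr.
    symmetry; exact (scal_one d).
  - rewrite g_scal_l, g_scal_r, <- hrr; field; exact hr.
  - rewrite g_scal_r, (hconst s) by assumption; unfold r; field.
    split; [lra|].
    intros h; apply hr; unfold r; rewrite h; unfold Rdiv; ring.
  - rewrite g_scal_r.
    assert (h : kappa s * g (N s) d = 0).
    { rewrite <- (is_derive_unique _ _ _ (hder s H)).
      apply is_derive_unique.
      apply (is_derive_ext_loc (fun _ => g (T s0) d)).
      - apply (filter_imp (rbar_interval a b)).
        + intros t ht; symmetry; apply hconst, ht.
        + apply locally_rbar_interval, H.
      - apply (is_derive_const (K := R_AbsRing) (V := R_NormedModule)). }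
    apply Rmult_integral in h; destruct h as [h|h].
    + contradiction (hk s H).
    + rewrite h; ring.
Qed.

(** Coordinates in the frame made of the normalized component of [T0] orthogonal
    to the axis, the normal [N0], and the axis. Building the frame from [T0] and
    [N0] themselves makes [x1 (L T0) = c] and [x2 (L N0) = 1], so both signs are
    right from the start. *)
Lemma adapted_isometry (T0 N0 U : E13) (n c : R) :
  0 < c -> c * c = n ^ 2 - 1 ->
  g T0 T0 = 1 -> g N0 N0 = 1 -> g U U = 1 ->
  g T0 N0 = 0 -> g T0 U = n -> g N0 U = 0 ->
  exists L : E13 -> E13, is_linear L /\
    (forall u v : E13, g (L u) (L v) = g u v) /\
    L U = e3 /\ 0 < x1 (L T0) /\ 0 < x2 (L N0).
Proof.
  intros hc hcc hTT hNN hUU hTN hTU hNU.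
  set (E1 := scal (/ c) (plus T0 (scal (- n) U))).
  assert (hE : forall v, g v E1 = / c * (g v T0 + - n * g v U)).
  { intros v; unfold E1; rewrite g_scal_r, g_plus_r, g_scal_r; reflexivity. }
  assert (hT1 : g T0 E1 = - c).
  { rewrite hE, hTT, hTU.
    replace (1 + - n * n) with (- (c * c)) by (rewrite hcc; ring).
    field; lra. }
  assert (hU1 : g U E1 = 0) by (rewrite hE, (g_sym U T0), hTU, hUU; field; lra).
  assert (hN1 : g N0 E1 = 0) by (rewrite hE, (g_sym N0 T0), hTN, hNU; field; lra).
  assert (ho : lorentz_orthonormal E1 N0 U).
  { repeat split; auto; try (rewrite g_sym; assumption).
    rewrite hE, (g_sym E1 T0), (g_sym E1 U), hT1, hU1; field; lra. }
  exists (frame_coords E1 N0 U); repeat split.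
  - apply is_linear_frame_coords.
  - apply is_linear_frame_coords.
  - apply is_linear_frame_coords.
  - intros u v; apply frame_coords_isometric, ho.
  - unfold frame_coords, e3; rewrite hU1, (g_sym U N0), hNU, hUU, Ropp_0.
    reflexivity.
  - change (0 < - g T0 E1); lra.
  - change (0 < g N0 N0); lra.
Qed.

(** The Frenet equations define [kappa] only through [T' = kappa N], so its
    continuity has to be drawn from that of the second derivative of [psi]. *)
Lemma frenet_curvature_continuous (a b : Rbar) (psi T N B : R -> E13)
  (kappa tau : R -> R) :
  smooth_on (rbar_interval a b) psi ->
  frenet_apparatus (rbar_interval a b) psi T N B kappa tau 1 ->
  forall s, rbar_interval a b s -> continuous kappa s.
Proof.
  intros hsm [_ hF].
  assert (hpsi : forall s, rbar_interval a b s -> is_derive psi s (T s))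
    by (intros s hs; destruct (hF s hs) as (h & _); exact h).
  assert (hT : forall s, rbar_interval a b s ->
            is_derive T s (scal (kappa s) (N s)))
    by (intros s hs; destruct (hF s hs) as (_&_&_&_&_&_&_&h&_); exact h).
  assert (hcoord : forall l : E13 -> R, is_linear (V := R_NormedModule) l ->
    (forall s, rbar_interval a b s -> ex_derive_n (fun t => l (psi t)) 3 s) ->
    forall s, rbar_interval a b s -> continuous (fun t => kappa t * l (N t)) s).
  { intros l hl h3.
    apply (second_derivative_continuous a b (fun t => l (psi t))
             (fun t => l (T t))); [| |exact h3]; intros s hs.
    - exact (is_derive_linear _ _ _ _ hl (hpsi s hs)).
    - pose proof (is_derive_linear _ _ _ _ hl (hT s hs)) as h.
      rewrite (linear_scal _ hl) in h; exact h. }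
  assert (hN : forall l : E13 -> R, is_linear (V := R_NormedModule) l ->
    forall s, rbar_interval a b s -> continuous (fun t => l (N t)) s).
  { intros l hl s hs; destruct (hF s hs) as (_&_&_&_&_&_&_&_&h&_).
    exact (is_derive_continuous _ _ _ (is_derive_linear _ _ _ _ hl h)). }
  intros s hs.
  (* kappa = g(T', N), a polynomial in continuous coordinates. *)
  assert (hsum : forall t, rbar_interval a b t ->
    (-1) * (kappa t * x1 (N t) * x1 (N t))
    + kappa t * x2 (N t) * x2 (N t) + kappa t * x3 (N t) * x3 (N t) = kappa t).
  { intros t ht; destruct (hF t ht) as (_&_&h&_); unfold g in h.
    rewrite <- (Rmult_1_r (kappa t)) at 4; rewrite <- h; ring. }
  apply (continuous_ext_loc kappa _ s
           (filter_imp _ _ hsum (locally_rbar_interval a b s hs))).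
  repeat apply (continuous_plus (K := R_AbsRing) (V := R_NormedModule)).
  - apply (continuous_scal_r (K := R_AbsRing) (V := R_NormedModule) (-1)).
    apply (continuous_mult (K := R_AbsRing)).
    + apply (hcoord x1 is_linear_x1); [intros t ht; apply hsm, ht | exact hs].
    + apply (hN x1 is_linear_x1 s hs).
  - apply (continuous_mult (K := R_AbsRing)).
    + apply (hcoord x2 is_linear_x2); [intros t ht; apply hsm, ht | exact hs].
    + apply (hN x2 is_linear_x2 s hs).
  - apply (continuous_mult (K := R_AbsRing)).
    + apply (hcoord x3 is_linear_x3); [intros t ht; apply hsm, ht | exact hs].
    + apply (hN x3 is_linear_x3 s hs).
Qed.

(** * Both representations of the position vector *)

(** One statement for the two representations: [w] constant and [u] a primitive
    of the curvature for the natural one, [w] proportional to the inverse of the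
    curvature and [u] the identity for the parametric one. *)
Lemma indefinite_integral_helix (J : R -> Prop) (w u : R -> R) (k m : R)
  (F : R -> E13) :
  interval_like J ->
  (forall s, J s -> continuous w s) -> (forall s, J s -> continuous u s) ->
  (forall s, J s -> is_derive F s
     (scal (w s) (vec (cosh (k * u s)) (sinh (k * u s)) m))) ->
  indefinite_integral J
    (fun s => scal (w s) (vec (cosh (k * u s)) (sinh (k * u s)) m)) F.
Proof.
  intros hJ hw hu hF.
  assert (hku : forall s, J s -> continuous (fun t => k * u t) s).
  { intros s hs.
    apply (continuous_scal_r (K := R_AbsRing) (V := R_NormedModule) k), hu, hs. }
  apply indefinite_integral_coords;
    apply indefinite_integral_of_derivative; auto; intros s hs.
  - exact (is_derive_linear _ _ _ _ is_linear_x1 (hF s hs)).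
  - apply (continuous_mult (K := R_AbsRing)); [auto|].
    apply (continuous_comp (fun t => k * u t) cosh); [auto|].
    apply (is_derive_continuous cosh _ (sinh (k * u s))), is_derive_Reals,
      derivable_pt_lim_cosh.
  - exact (is_derive_linear _ _ _ _ is_linear_x2 (hF s hs)).
  - apply (continuous_mult (K := R_AbsRing)); [auto|].
    apply (continuous_comp (fun t => k * u t) sinh); [auto|].
    apply (is_derive_continuous sinh _ (cosh (k * u s))), is_derive_Reals,
      derivable_pt_lim_sinh.
  - exact (is_derive_linear _ _ _ _ is_linear_x3 (hF s hs)).
  - apply (continuous_mult (K := R_AbsRing)); [auto|].
    apply (continuous_const m).
Qed.

Theorem theorem3p6
  (a b : Rbar) (hab : Rbar_lt a b)
  (psi T N B : R -> E13) (kappa tau : R -> R) (eps : R)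
  (hsmooth : smooth_on (rbar_interval a b) psi)
  (hfrenet : frenet_apparatus (rbar_interval a b) psi T N B kappa tau eps)
  (hkappa : forall s : R, rbar_interval a b s -> kappa s <> 0)
  (hN : forall s : R, rbar_interval a b s -> spacelike (N s))
  (q d : E13) (hd : spacelike d) (hd0 : d <> zero)
  (phi : R)
  (hhelix : forall s : R, rbar_interval a b s ->
     lorentzian_timelike_angle (T s) d phi)
  (n m : R) (hn : n = cosh phi) (hm : m = n / sqrt (n ^ 2 - 1)) :
  exists Phi : E13 -> E13,
    isometry Phi /\
    (exists q' : E13, forall p : E13, line q d p <-> line q' e3 (Phi p)) /\
    exists theta : R -> R,
      indefinite_integral (rbar_interval a b) kappa theta /\
      indefinite_integral (rbar_interval a b)
        (fun s : R => scal (sqrt (n ^ 2 - 1))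
           (vec (cosh (sqrt (m ^ 2 - 1) * theta s))
                (sinh (sqrt (m ^ 2 - 1) * theta s))
                m))
        (fun s : R => Phi (psi s)) /\
      exists sigma : R -> R,
        (forall s : R, rbar_interval a b s -> sigma (theta s) = s) /\
        indefinite_integral (image (rbar_interval a b) theta)
          (fun t : R => scal (sqrt (n ^ 2 - 1) / kappa (sigma t))
             (vec (cosh (sqrt (m ^ 2 - 1) * t))
                  (sinh (sqrt (m ^ 2 - 1) * t))
                  m))
          (fun t : R => Phi (psi (sigma t))).
Proof.
  set (I := rbar_interval a b) in *.
  destruct (rbar_interval_nonempty a b hab) as [s0 hs0]; fold I in hs0.
  pose proof hfrenet as [heps hF].
  assert (hI : interval_like I) by exact (interval_like_rbar a b).
  assert (he : eps = 1).
  { destruct (hF s0 hs0) as (_&_&hNN&_).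
    destruct (hN s0 hs0) as [h|h].
    - lra.
    - exfalso; rewrite h in hNN.
      change (- (0 * 0) + 0 * 0 + 0 * 0 = eps) in hNN; lra. }
  subst eps.
  assert (hT : forall s, I s -> is_derive T s (scal (kappa s) (N s)))
    by (intros s hs; destruct (hF s hs) as (_&_&_&_&_&_&_&h&_); exact h).
  assert (hTT : forall s, I s -> g (T s) (T s) = 1)
    by (intros s hs; destruct (hF s hs) as (_&h&_); exact h).
  assert (hNN : forall s, I s -> g (N s) (N s) = 1)
    by (intros s hs; destruct (hF s hs) as (_&_&h&_); exact h).
  assert (hTN : forall s, I s -> g (T s) (N s) = 0)
    by (intros s hs; destruct (hF s hs) as (_&_&_&_&h&_); exact h).
  destruct (helix_unit_axis a b T N kappa d phi n) as (hn1 & r & U & hr & hdU &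
    hUU & hTNU); auto.
  destruct (helix_constants n m hn1 hm) as (hc & hcc & hcm & hmc).
  assert (hnn : 1 < n * n) by nra.
  set (c := sqrt (n ^ 2 - 1)) in *.
  rewrite hmc.
  destruct (adapted_isometry (T s0) (N s0) U n c) as (L & hL & hLg & hLU &
    hLT0 & hLN0); auto; try apply hTNU; auto.
  (* The constants of integration absorb any translation, so the isometry is
     taken linear. *)
  exists L; split; [|split].
  - exists L, zero; repeat split; auto; try apply hL.
    intros p; symmetry; apply plus_zero_r.
  - exists (L q); exact (line_linear_image L q d U r hL hLg hr hdU hLU).
  - assert (hX : forall s, I s ->
      is_derive (fun t => L (T t)) s (scal (kappa s) (L (N s)))).
    { intros s hs; rewrite <- (linear_scal _ hL).
      apply is_derive_linear; auto. }
    assert (hXX : forall s, I s -> g (L (T s)) (L (T s)) = 1)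
      by (intros s hs; rewrite hLg; auto).
    assert (hYY : forall s, I s -> g (L (N s)) (L (N s)) = 1)
      by (intros s hs; rewrite hLg; auto).
    assert (hX3 : forall s, I s -> x3 (L (T s)) = n)
      by (intros s hs; rewrite <- g_e3, <- hLU, hLg; apply hTNU, hs).
    assert (hY3 : forall s, I s -> x3 (L (N s)) = 0)
      by (intros s hs; rewrite <- g_e3, <- hLU, hLg; apply hTNU, hs).
    (* x1 T and x2 N cannot vanish, so the signs fixed at s0 persist. *)
    assert (hX1 : forall s, I s -> 0 < x1 (L (T s))).
    { intros s hs; apply (Rmult_lt_reg_l (x1 (L (T s0)))); [exact hLT0|].
      rewrite Rmult_0_r.
      apply (nonvanishing_same_sign I (fun t => x1 (L (T t))));
        auto; intros t ht.
      - exact (is_derive_continuous _ _ _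
                 (is_derive_linear _ _ _ _ is_linear_x1 (hX t ht))).
      - pose proof (hXX t ht) as h; unfold g in h; rewrite (hX3 t ht) in h.
        intros h0; rewrite h0 in h.
        pose proof (Rle_0_sqr (x2 (L (T t)))) as hsq; unfold Rsqr in hsq; lra. }
    assert (hY2 : forall s, I s -> 0 < x2 (L (N s))).
    { intros s hs; apply (Rmult_lt_reg_l (x2 (L (N s0)))); [exact hLN0|].
      rewrite Rmult_0_r.
      apply (nonvanishing_same_sign I (fun t => x2 (L (N t))));
        auto; intros t ht.
      - destruct (hF t ht) as (_&_&_&_&_&_&_&_&h&_).
        exact (is_derive_continuous _ _ _ (is_derive_linear _ _ _ _
                 (is_linear_comp _ _ hL is_linear_x2) h)).
      - pose proof (hYY t ht) as h; unfold g in h; rewrite (hY3 t ht) in h.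
        intros h0; rewrite h0 in h.
        pose proof (Rle_0_sqr (x1 (L (N t)))) as hsq; unfold Rsqr in hsq; lra. }
    destruct (hyperbolic_angle I (fun s => L (T s)) (fun s => L (N s)) kappa n c)
      as [theta htheta]; auto.
    { intros s hs; rewrite hLg; auto. }
    assert (hth : forall s, I s -> is_derive theta s (kappa s))
      by (intros s hs; apply htheta, hs).
    assert (hkc : forall s, I s -> continuous kappa s)
      by exact (frenet_curvature_continuous a b psi T N B kappa tau
                  hsmooth hfrenet).
    assert (hLT : forall s, I s -> L (T s) =
      scal c (vec (cosh (/ c * theta s)) (sinh (/ c * theta s)) m)).
    { intros s hs; destruct (htheta s hs) as (_ & h1 & h2).
      apply E13_ext; [exact h1 | exact h2 | rewrite hX3 by exact hs].
      symmetry; exact hcm. }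
    assert (hpsi : forall s, I s -> is_derive (fun t => L (psi t)) s (L (T s))).
    { intros s hs; destruct (hF s hs) as (h & _).
      exact (is_derive_linear _ _ _ _ hL h). }
    exists theta; split; [|split].
    + apply indefinite_integral_of_derivative; auto.
    + apply indefinite_integral_helix; auto.
      * intros s hs; apply (continuous_const c).
      * intros s hs; exact (is_derive_continuous _ _ _ (hth s hs)).
      * intros s hs; rewrite <- hLT; auto.
    + set (sigma := fun t =>
        epsilon (inhabits 0) (fun s => I s /\ theta s = t)).
      assert (hsigma : forall s, I s -> sigma (theta s) = s).
      { intros s hs.
        destruct (epsilon_spec (inhabits 0)
                    (fun u => I u /\ theta u = theta s)) as [h1 h2].
        - exists s; auto.
        - exact (primitive_injective a b theta kappa hth hkc hkappa
                   (sigma (theta s)) s h1 hs h2). }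
      exists sigma; split; [exact hsigma|].
      apply (indefinite_integral_helix (image I theta)
               (fun t => c / kappa (sigma t)) (fun t => t)).
      * exact (image_primitive_interval_like a b theta kappa hth).
      * intros t (s & hs & <-).
        apply (continuous_scal_r (K := R_AbsRing) (V := R_NormedModule) c).
        apply continuous_Rinv_comp; [|rewrite hsigma; auto].
        apply continuous_comp.
        -- exact (inverse_primitive_continuous a b theta kappa hth hkc hkappa
                    sigma hsigma s hs).
        -- rewrite hsigma; auto.
      * intros t _; apply continuous_id.
      * intros t (s & hs & <-); rewrite hsigma by exact hs.
        replace (scal (c / kappa s) _) with (scal (/ kappa s) (L (T s))).
        { apply (is_derive_comp (fun t => L (psi t)) sigma).
          - rewrite hsigma; auto.
          - exact (is_derive_inverse_primitive a b theta kappa hth hkc hkappa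
                     sigma hsigma s hs). }
        rewrite (hLT s hs), scal_assoc; f_equal; apply Rmult_comm.
Qed.
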